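(* Let $(W,S)$ be a Coxeter system and $<$ a total order on $S$. For $w\in W$ let $\min(w)$ be the lexicographically smallest element of $\mathcal R(w)$. Then the language $\mathcal L(W,S,<)=\{\min(w): w\in W^{FC}\}\subseteq S^*$ is regular. In particular its length generating function equals $W^{FC}(t)=\sum_{w\in W^{FC}}t^{\ell(w)}$.
   Context: Coxeter system $(W,S)$ with matrix $(m_{st})$, length $\ell$, and set $\mathcal R(w)$ of reduced expressions. $w$ is fully commutative (FC) if $\mathcal R(w)$ is a single class for the equivalence generated by $\mathbf u st\mathbf v\sim\mathbf u ts\mathbf v$ when $m_{st}=2$; $W^{FC}$ is the set of FC elements. Lexicographic order on $S^*$ induced by $<$: $\mathbf w_1<\mathbf w_2$ if $\mathbf w_1$ is a strict prefix of $\mathbf w_2$, or $\mathbf w_1=\mathbf w s\mathbf w'$, $\mathbf w_2=\mathbf w t\mathbf w''$ with $s<t$. A language is regular if it is recognized by a finite deterministic automaton. *)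

(* Defs.v *)
From mathcomp Require Import all_boot.
Set Implicit Arguments. Unset Strict Implicit. Unset Printing Implicit Defensive.

(* A Coxeter matrix on a finite generating set S: m s t = 0 encodes m_st = oo. *)
Definition coxeter_matrix (S : finType) (m : S -> S -> nat) : Prop :=
  (forall s, m s s = 1) /\ (forall s t, m s t = m t s) /\
  (forall s t, s != t -> m s t != 1).

Fixpoint alt (S : Type) (s t : S) (k : nat) : seq S :=
  if k is k'.+1 then s :: alt t s k' else [::].

(* Equality in W of the elements represented by two words: the monoid
   congruence on S^* generated by s s = 1 and (s t)^{m_st} = 1 (m_st finite),
   i.e. the defining presentation of the Coxeter group W. *)
Inductive weq (S : finType) (m : S -> S -> nat) : seq S -> seq S -> Prop :=
| weq_refl x : weq m x x
| weq_sym x y : weq m x y -> weq m y x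
| weq_trans x y z : weq m x y -> weq m y z -> weq m x z
| weq_inv u v s : weq m (u ++ [:: s; s] ++ v) (u ++ v)
| weq_rel u v s t : 0 < m s t -> weq m (u ++ alt s t (2 * m s t) ++ v) (u ++ v).

Definition reduced (S : finType) (m : S -> S -> nat) (x : seq S) : Prop :=
  forall y, weq m x y -> size x <= size y.

Inductive ceq (S : finType) (m : S -> S -> nat) : seq S -> seq S -> Prop :=
| ceq_refl x : ceq m x x
| ceq_sym x y : ceq m x y -> ceq m y x
| ceq_trans x y z : ceq m x y -> ceq m y z -> ceq m x z
| ceq_swap u v s t : m s t = 2 -> ceq m (u ++ [:: s; t] ++ v) (u ++ [:: t; s] ++ v).

Definition fc_word (S : finType) (m : S -> S -> nat) (x : seq S) : Prop :=
  forall y z, reduced m y -> reduced m z -> weq m x y -> weq m x z -> ceq m y z.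

Definition strict_total_order (S : finType) (lt : rel S) : Prop :=
  (forall s, ~~ lt s s) /\ (forall s t u, lt s t -> lt t u -> lt s u) /\
  (forall s t, s != t -> lt s t || lt t s).

Fixpoint lexlt (S : finType) (lt : rel S) (x y : seq S) : bool :=
  match x, y with
  | [::], [::] => false
  | [::], _ :: _ => true
  | _ :: _, [::] => false
  | a :: x', b :: y' => lt a b || ((a == b) && lexlt lt x' y')
  end.

Definition is_lexmin (S : finType) (m : S -> S -> nat) (lt : rel S) (x : seq S) : Prop :=
  reduced m x /\ forall y, reduced m y -> weq m x y -> y <> x -> lexlt lt x y.

Definition FC_lang (S : finType) (m : S -> S -> nat) (lt : rel S) (x : seq S) : Prop :=
  is_lexmin m lt x /\ fc_word m x.

Record dfa (S : finType) := DFA {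
  dfa_state : finType;
  dfa_start : dfa_state;
  dfa_delta : dfa_state -> S -> dfa_state;
  dfa_accept : pred dfa_state }.

Definition dfa_accepts (S : finType) (A : dfa S) (x : seq S) : bool :=
  @dfa_accept S A (foldl (@dfa_delta S A) (@dfa_start S A) x).

Definition regular (S : finType) (L : seq S -> Prop) : Prop :=
  exists A : dfa S, forall x, dfa_accepts A x <-> L x.

(* the number of elements of W^FC of length n equals c: there are exactly c
   pairwise distinct elements (given by reduced expressions, necessarily of
   length n) that are FC of length n, and every FC element of length n is
   one of them *)
Definition num_FC_of_length (S : finType) (m : S -> S -> nat) (n c : nat) : Prop :=
  exists reps : seq (seq S),
    size reps = c /\
    (forall x, x \in reps -> [/\ size x = n, reduced m x & fc_word m x]) /\
    (forall i j, i < size reps -> j < size reps ->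
        weq m (nth [::] reps i) (nth [::] reps j) -> i = j) /\
    (forall y, size y = n -> reduced m y -> fc_word m y ->
        exists2 x, x \in reps & weq m x y).

Definition num_words_of_length (S : finType) (L : seq S -> Prop) (n c : nat) : Prop :=
  exists ws : seq (seq S),
    size ws = c /\ uniq ws /\
    (forall x, x \in ws <-> (size x = n /\ L x)).

(* Main.v *)
Require Import Defs.
From mathcomp Require Import all_boot boolp.
From Stdlib Require Import Setoid Morphisms.

(* By the exchange condition and Matsumoto's theorem, two reduced words of the
   same element are related by the braid moves of length the true order of st
   in W (so no linear representation, showing that this order is m s t, is
   needed).  Hence x is a reduced word of a fully commutative element iff no
   word commutation-equivalent to x has a factor ss or a braid that is not a
   mere commutation; x is the lexicographic minimum iff no letter can be moved
   left by commutations past a block starting with a larger letter.  Reading x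
   from left to right, both conditions need only finite memory.  For a forbidden
   factor p, remember all pairs (i, A) such that x is equivalent to some
   u (first i letters of p) v with A the set of letters of v: consecutive
   letters of p do not commute, so the next letter of x can only join the end of
   u, of the part of p, or of v.  For minimality, remember the set of letters
   that could be moved past such a block. *)

(** * Equality in the Coxeter group and parities of reflections *)

Section WordProblem.
Set Implicit Arguments. Unset Strict Implicit. Unset Printing Implicit Defensive.
Variables (S : finType) (m : S -> S -> nat).
#[local] Hint Resolve weq_refl : core.
Implicit Types (s t a : S) (x y z u v r p : seq S).

Lemma size_alt s t k : size (alt s t k) = k.
Proof. by elim: k s t => //= k IH s t; rewrite IH. Qed.

Lemma alt_double_cat s t i k :
  alt s t (2 * i + k) = alt s t (2 * i) ++ alt s t k.
Proof. by elim: i => [|i IH] //; rewrite mulnS /= IH. Qed.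

Lemma cons_alt_rcons s t i : s :: alt t s (2 * i).+1 ++ [:: s] = alt s t (2 * i.+1).+1.
Proof.
have -> : (2 * i.+1).+1 = (2 * i + 2).+1 by rewrite mulnS addnC.
by rewrite -(addn1 (2 * i)) /= !alt_double_cat -catA.
Qed.

Lemma alt_cat_prefix s t k l : k <= l -> exists v, alt s t l = alt s t k ++ v.
Proof.
elim: k l s t => [|k IH] [|l] s t //= kl; first by exists [::].
  by exists (s :: alt t s l).
by have [v ->] := IH l t s kl; exists v.
Qed.

#[local] Instance weq_equiv : Equivalence (weq m).
Proof. by split; [exact: weq_refl | exact: weq_sym | exact: weq_trans]. Qed.

Lemma weq_context u x y v : weq m x y -> weq m (u ++ x ++ v) (u ++ y ++ v).
Proof.
move=> xy; elim: xy u v => {x y} [x|x y _ IH|x y z _ IH1 _ IH2|u v s|u v s t st] u' v'.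
- exact: weq_refl.
- exact/weq_sym/IH.
- exact: weq_trans (IH1 _ _) (IH2 _ _).
- by have := weq_inv m (u' ++ u) (v ++ v') s; rewrite -!catA.
- by have := weq_rel (u' ++ u) (v ++ v') st; rewrite -!catA.
Qed.

#[local] Instance weq_cat : Proper (weq m ==> weq m ==> weq m) cat.
Proof.
move=> x x' xx' y y' yy'; apply: (@weq_trans _ _ _ (x' ++ y)).
  exact: (weq_context [::] y xx').
by have := weq_context x' [::] yy'; rewrite !cats0.
Qed.

#[local] Instance weq_cons s : Proper (weq m ==> weq m) (cons s).
Proof. by move=> x y; apply: (@weq_cat [:: s] [:: s]); exact: weq_refl. Qed.

Lemma weq_cancel s x : weq m (s :: s :: x) x.
Proof. exact: (weq_inv m [::] x s). Qed.

Lemma weq_consI s x y : weq m (s :: x) (s :: y) -> weq m x y.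
Proof. by move=> /(weq_cons s); rewrite !weq_cancel. Qed.

Lemma weq_cat_rev x : weq m (x ++ rev x) [::].
Proof.
elim: x => [|s x IH] /=; first exact: weq_refl.
by rewrite rev_cons -cats1 catA IH; exact: weq_cancel.
Qed.

Lemma weq_rev_cat x : weq m (rev x ++ x) [::].
Proof. by rewrite -{2}(revK x); exact: weq_cat_rev. Qed.

Lemma weq_conj s r x : weq m (s :: r ++ [:: s]) x <-> weq m r (s :: x ++ [:: s]).
Proof.
split=> [<-|->].
  by rewrite /= -catA /= weq_cancel (weq_cancel s [::]) cats0.
by rewrite /= -catA /= weq_cancel (weq_cancel s [::]) cats0.
Qed.

(* In the group, the word [s1..sk] yields the reflections s1..si..s1; this is
   the parity of the number of those equal to [r]. *)
Fixpoint refl_parity x r : bool :=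
  if x is s :: x' then `[< weq m r [:: s] >] (+) refl_parity x' (s :: r ++ [:: s])
  else false.

Lemma refl_parity_weq x r r' : weq m r r' -> refl_parity x r = refl_parity x r'.
Proof.
elim: x r r' => //= s x IH r r' rr'; congr (_ (+) _).
  by apply: asbool_equiv_eq; rewrite rr'.
by apply: IH; rewrite rr'; exact: weq_refl.
Qed.

(** Cocycle rule: [rev u] represents the inverse of [u], so each reflection coming from [v] is
    conjugated by [u]. *)
Lemma refl_parity_cat u v r :
  refl_parity (u ++ v) r = refl_parity u r (+) refl_parity v (rev u ++ r ++ u).
Proof.
elim: u r => [|s u IH] r /=; first by rewrite cats0.
by rewrite IH addbA rev_cons -cats1 -!catA /= -!catA.
Qed.

(** Conjugation by the first letter adds one letter at each end, so the reflections of an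
    alternating word are the alternating words of odd length. *)
Lemma refl_parity_alt s t k r :
  refl_parity (alt s t k) r =
  \big[addb/false]_(i < k) `[< weq m r (alt s t (2 * i).+1) >].
Proof.
elim: k s t r => [|k IH] s t r; first by rewrite big_ord0.
rewrite [LHS]/= big_ord_recl; congr (_ (+) _).
rewrite IH; apply: eq_bigr => i _; apply: asbool_equiv_eq.
by rewrite lift0 -cons_alt_rcons; exact: weq_conj.
Qed.

(** Since [(s t)^(m s t)] is trivial, the reflections with indices [i] and [m s t + i] coincide, and
    the two halves of the sum cancel. *)
Lemma refl_parity_rel s t r : 0 < m s t -> refl_parity (alt s t (2 * m s t)) r = false.
Proof.
move=> st; rewrite refl_parity_alt.
have split n (F : nat -> bool) : n = m s t + m s t ->
    \big[addb/false]_(i < n) F i =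
    \big[addb/false]_(i < m s t) F i (+) \big[addb/false]_(i < m s t) F (m s t + i).
  by move=> ->; rewrite big_split_ord.
rewrite (split _ (fun i => `[< weq m r (alt s t (2 * i).+1) >])) ?mul2n ?addnn //.
set A := (X in X (+) _); set B := (X in _ (+) X).
suff -> : B = A by rewrite addbb.
apply: eq_bigr => i _; apply: asbool_equiv_eq.
have -> : alt s t (2 * (m s t + i)).+1 = alt s t (2 * m s t) ++ alt s t (2 * i).+1.
  by rewrite -alt_double_cat addnS -mulnDr.
have -> // : weq m (alt s t (2 * m s t)) [::].
by have := weq_rel [::] [::] st; rewrite cats0.
Qed.

(** A relator has parity zero at every reflection and, being trivial in the group, does not change
    the conjugation applied to what follows it. This makes the parity a function of the group
    element. *)
Lemma refl_parity_inv x y : weq m x y -> refl_parity x =1 refl_parity y.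
Proof.
have drop u p v : weq m p [::] -> (forall r, refl_parity p r = false) ->
    refl_parity (u ++ p ++ v) =1 refl_parity (u ++ v).
  move=> p1 p0 r; rewrite !refl_parity_cat p0 /=; congr (_ (+) _).
  apply: refl_parity_weq; have p1' : weq m (rev p) [::].
    by have := weq_rev_cat p; rewrite {2}p1 cats0.
  by rewrite p1' p1 cats0.
elim=> {x y} [//|x y _ IH|x y z _ IH1 _ IH2|u v s|u v s t st] r.
- by rewrite IH.
- by rewrite IH1.
- apply: drop => [|r' /=]; first exact: weq_cancel.
  rewrite addbF; set A := asbool _; set B := asbool _.
  suff -> : A = B by rewrite addbb.
  apply: asbool_equiv_eq; rewrite weq_conj /=; split=> ->.
    by rewrite weq_cancel; exact: weq_refl.
  by rewrite weq_cancel; exact: weq_refl.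
- apply: drop => [|r']; last exact: refl_parity_rel.
  by have := weq_rel [::] [::] st; rewrite cats0.
Qed.

Lemma refl_parityP x r : refl_parity x r ->
  exists u a v, x = u ++ a :: v /\ weq m r (u ++ a :: rev u).
Proof.
elim: x r => //= s x IH r; case: asboolP => [rs _|_ /IH [u [a [v [-> H]]]]].
  by exists [::], s, x.
exists (s :: u), a, v; split=> //.
by move/weq_conj: H; rewrite rev_cons -cats1 /= -catA.
Qed.

Lemma refl_exchange x s : refl_parity x [:: s] ->
  exists u a v, x = u ++ a :: v /\ weq m x (s :: u ++ v).
Proof.
move=> /refl_parityP[u [a [v [xE H]]]]; exists u, a, v; split=> //.
have -> : weq m (s :: u ++ v) ((u ++ a :: rev u) ++ u ++ v) by rewrite -H.
have -> : (u ++ a :: rev u) ++ u ++ v = u ++ a :: (rev u ++ u) ++ v by rewrite -!catA.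
by rewrite xE weq_rev_cat.
Qed.

(** * Reduced words, the exchange condition and braid moves *)

Lemma nonreducedP x : ~ reduced m x -> exists2 y, reduced m y & weq m x y /\ size y < size x.
Proof.
elim: {x}_.+1 {-2}x (ltnSn (size x)) => // n IH x; rewrite ltnS => xn nr.
have [y xy yx] : exists2 y, weq m x y & size y < size x.
  move/existsNP: nr => [y /not_implyP [xy /negP]]; rewrite -ltnNge => yx.
  by exists y.
have [yr|yr] := EM (reduced m y); first by exists y.
have [z zr [yz zy]] := IH y (leq_trans yx xn) yr.
by exists z => //; split; [exact: weq_trans yz | exact: ltn_trans yx].
Qed.

Lemma reduced_weq x y : reduced m x -> weq m x y -> size y <= size x -> reduced m y.
Proof. by move=> xr xy s z yz; apply: leq_trans s _; apply: xr; apply: weq_trans yz. Qed.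

Lemma weq_reduced_size x y : reduced m x -> reduced m y -> weq m x y -> size x = size y.
Proof. by move=> xr yr xy; apply/eqP; rewrite eqn_leq xr // yr //; exact: weq_sym. Qed.

Lemma reduced_factor u x v : reduced m (u ++ x ++ v) -> reduced m x.
Proof.
move=> H y xy; have := H (u ++ y ++ v) (weq_context _ _ xy).
by rewrite !size_cat leq_add2l leq_add2r.
Qed.

(** If [x] has even parity at [s], then [s :: x] has odd parity there, and so does a reduced word
    [z] of the same element. Deleting a letter of [z] would then give a word for [x] shorter than
    [x]. *)
Lemma exchange x s : reduced m x -> ~ reduced m (s :: x) ->
  exists u a v, x = u ++ a :: v /\ weq m x (s :: u ++ v).
Proof.
move=> xr /nonreducedP[z zr [xz zx]].
have [|xs] := boolP (refl_parity x [:: s]); first exact: refl_exchange.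
have : refl_parity z [:: s].
  rewrite -(refl_parity_inv xz) /= asboolT; last exact: weq_refl.
  by rewrite -(@refl_parity_weq _ [:: s]) ?(negbTE xs) // weq_cancel; exact: weq_refl.
move=> /refl_exchange[u [a [v [zE zu]]]].
have : weq m x (u ++ v) by apply: (@weq_consI s); rewrite xz.
move=> /xr; move: zx; rewrite zE /= !size_cat /= addnS !ltnS => zx.
by rewrite leqNgt zx.
Qed.

(* [k] is the order of [st] in the group, or 1 if [s] and [t] are equal there;
   that it is [m s t] is not needed. *)
Definition is_braid s t k :=
  [/\ 0 < k, weq m (alt s t k) (alt t s k) &
      forall j, 0 < j < k -> ~ weq m (alt s t j) (alt t s j)].

Lemma is_braid_sym s t k : is_braid s t k -> is_braid t s k.
Proof.
move=> [k0 e H]; split=> // [|j /H nj e']; first exact: weq_sym.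
by apply: nj; exact: weq_sym.
Qed.

Inductive beq : seq S -> seq S -> Prop :=
| beq_refl x : beq x x
| beq_sym x y : beq x y -> beq y x
| beq_trans x y z : beq x y -> beq y z -> beq x z
| beq_braid u v s t k : is_braid s t k -> beq (u ++ alt s t k ++ v) (u ++ alt t s k ++ v).

Lemma beq_context u x y v : beq x y -> beq (u ++ x ++ v) (u ++ y ++ v).
Proof.
move=> xy; elim: xy u v => {x y} [x|x y _ IH|x y z _ IH1 _ IH2|u v s t k st] u' v'.
- exact: beq_refl.
- exact/beq_sym/IH.
- exact: beq_trans (IH1 _ _) (IH2 _ _).
- by have := beq_braid (u' ++ u) (v ++ v') st; rewrite -!catA.
Qed.

(** If the two alternating words already agreed at a length below [k], multiplying by [s] would
    shorten the alternating word that is one letter longer, which is a prefix of a reduced word. *)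
Lemma reduced_alt_braid s t k : 0 < k -> reduced m (alt s t k) ->
  weq m (alt s t k) (alt t s k) -> is_braid s t k.
Proof.
move=> k0 kr e; split=> // -[//|j] /= jk ej.
have [v E] := alt_cat_prefix s t jk.
move: kr; rewrite E => /(@reduced_factor [::] _ v) jr.
have : weq m (alt s t j.+2) (alt t s j).
  by have := weq_cons s ej; rewrite weq_cancel => /weq_sym.
by move/jr; rewrite !size_alt ltnNge leqnSn.
Qed.

(** Induction on the length; two words of the same element are linked through words that share a
    first or a last letter with their neighbours, or through a braid. *)
Lemma matsumoto x y : reduced m x -> reduced m y -> weq m x y -> beq x y.
Proof.
elim: {x}(size x) {-2}x (erefl (size x)) y => [|n IH] x xn y xr yr xy.
  have := weq_reduced_size xr yr xy; rewrite xn => /esym/size0nil ->.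
  by rewrite (size0nil xn); exact: beq_refl.
have first s z z' : size z = n -> reduced m (s :: z) -> reduced m (s :: z') ->
    weq m (s :: z) (s :: z') -> beq (s :: z) (s :: z').
  move=> zn zr z'r /weq_consI e; have := @beq_context [:: s] z z' [::].
  rewrite !cats0; apply; apply: IH => //.
    by apply: (@reduced_factor [:: s] _ [::]); rewrite cats0.
  by apply: (@reduced_factor [:: s] _ [::]); rewrite cats0.
have last_ s z z' : size z = n -> reduced m (rcons z s) -> reduced m (rcons z' s) ->
    weq m (rcons z s) (rcons z' s) -> beq (rcons z s) (rcons z' s).
  move=> zn zr z'r e; rewrite -!cats1; apply: (@beq_context [::]).
  move: zr z'r e; rewrite -!cats1 => zr z'r e.
  apply: IH => //; try exact: (@reduced_factor [::] _ [:: s]).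
  by move: (weq_cat e (weq_refl m [:: s])); rewrite -!catA /= (weq_cancel s [::]) !cats0.
(* Exchange deletes a letter of [x1] and puts [t] in front. If the deleted letter is not the last,
   the new word shares its last letter with [x1] and its first with [t :: y1], so induction settles
   both comparisons. *)
have step x1 t y1 : size x1 = n.+1 -> reduced m x1 -> reduced m (t :: y1) ->
    weq m x1 (t :: y1) -> beq x1 (t :: y1) \/
    exists x0 a, [/\ x1 = rcons x0 a, reduced m (t :: x0), weq m x1 (t :: x0) &
                     beq (t :: x0) (t :: y1)].
  move=> x1n x1r y1r e; have := weq_reduced_size x1r y1r e; rewrite x1n => -[y1n].
  have nr : ~ reduced m (t :: x1).
    move=> /(_ y1) H; have : weq m (t :: x1) y1 by rewrite e weq_cancel.
    by move=> /H; rewrite /= x1n y1n ltnNge leqnSn.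
  have [u [a [v [xE H]]]] := exchange x1r nr.
  have sv : size (u ++ v) = n by move: x1n; rewrite xE !size_cat /= addnS => -[].
  have vr : reduced m (t :: u ++ v) by apply: (reduced_weq x1r H); rewrite /= sv x1n.
  have ey : beq (t :: u ++ v) (t :: y1) by apply: first => //; rewrite -H.
  case/lastP: v xE H sv vr ey => [|v b] xE H sv vr ey.
    by right; exists u, a; rewrite !cats0 cats1 in xE H vr ey *.
  left; apply: beq_trans ey; move: H vr x1r x1n.
  rewrite xE -rcons_cons -!rcons_cat -rcons_cons => H vr x1r.
  by rewrite size_rcons => -[x1n]; apply: last_.
(* Whenever the last letter is deleted, the two words swap roles and the alternating prefix gains a
   letter. After at most [d] rounds the whole word alternates, and the remaining comparison is a
   braid. *)
suff chain d s t j z y0 : size z = d -> size (alt s t j ++ z) = n.+1 -> 0 < j ->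
    reduced m (alt s t j ++ z) -> reduced m (t :: y0) ->
    weq m (alt s t j ++ z) (t :: y0) -> beq (alt s t j ++ z) (t :: y0).
  have := weq_reduced_size xr yr xy; rewrite xn.
  case: x y xn xr yr xy => [//|s x] [//|t y] xn xr yr xy yn.
  exact: (chain (size x) s t 1 x y).
elim: d s t j z y0 => [|d IHd] s t [//|j] z y0 zd zn _ zr y0r e.
  rewrite (size0nil zd) cats0 in zn zr e *.
  have [//|[x0 [a [xE x0r e0 b0]]]] := step _ _ _ zn zr y0r e.
  apply: beq_trans b0; have altE : alt t s j.+1 = t :: x0.
    congr cons; have := congr1 (take j) xE; have := congr1 size xE.
    rewrite size_rcons -cats1 size_alt => -[->]; rewrite take_size_cat //= => <-.
    have [v] := alt_cat_prefix s t (leqnSn (size x0)).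
    by rewrite /= => ->; rewrite take_size_cat ?size_alt.
  rewrite -altE in e0 *.
  have := beq_braid [::] [::] (reduced_alt_braid (ltn0Sn _) zr e0).
  by rewrite /= !cats0.
have [//|[x0 [a [xE x0r e0 b0]]]] := step _ _ _ zn zr y0r e.
apply: beq_trans b0; apply: beq_sym.
case/lastP: z zd xE zn zr e e0 => [//|z b]; rewrite size_rcons => -[zd].
rewrite -rcons_cat => /rcons_inj[x0E _] zn zr e e0; rewrite -x0E in x0r e0 *.
apply: (IHd t s j.+2 z _ zd) => //.
- by move: zn; rewrite size_rcons => -[zn]; rewrite /= zn.
- exact: weq_sym.
Qed.

End WordProblem.

(** * Commutation classes of words *)

Section Commutation.
Set Implicit Arguments. Unset Strict Implicit. Unset Printing Implicit Defensive.
Variables (S : finType) (m : S -> S -> nat).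
Hypothesis m_cox : coxeter_matrix m.
#[local] Hint Resolve weq_refl ceq_refl : core.
#[local] Existing Instance weq_equiv.
#[local] Existing Instance weq_cat.
#[local] Existing Instance weq_cons.
Implicit Types (s t a b : S) (x y z u v p : seq S).

Let mC s t : m s t = m t s. Proof. by case: m_cox => _ []. Qed.
Let m1 s : m s s = 1. Proof. by case: m_cox. Qed.

Lemma ceq_context u x y v : ceq m x y -> ceq m (u ++ x ++ v) (u ++ y ++ v).
Proof.
move=> xy; elim: xy u v => {x y} [x|x y _ IH|x y z _ IH1 _ IH2|u v s t st] u' v' //.
- exact/ceq_sym/IH.
- exact: ceq_trans (IH1 _ _) (IH2 _ _).
- by have := ceq_swap (u' ++ u) (v ++ v') st; rewrite -!catA.
Qed.

Lemma ceq_catl u x y : ceq m x y -> ceq m (u ++ x) (u ++ y).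
Proof. by move=> /(ceq_context u [::]); rewrite !cats0. Qed.

Lemma ceq_catr v x y : ceq m x y -> ceq m (x ++ v) (y ++ v).
Proof. exact: (ceq_context [::]). Qed.

Lemma ceq_weq x y : ceq m x y -> weq m x y.
Proof.
elim=> {x y} [x|x y _ IH|x y z _ IH1 _ IH2|u v s t st] //.
- exact: weq_sym.
- exact: weq_trans IH2.
- apply: weq_context; have := @weq_rel _ m [::] [::] s t; rewrite st /= => /(_ isT) e.
  have {}e := weq_cons t (weq_cons s e); rewrite weq_cancel in e.
  by rewrite weq_cancel in e.
Qed.

Lemma ceq_perm x y : ceq m x y -> perm_eq x y.
Proof.
elim=> {x y} [x|x y _ IH|x y z _ IH1 _ IH2|u v s t st] //.
- by rewrite perm_sym.
- exact: perm_trans IH2.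
- by rewrite perm_cat2l perm_cat2r (perm_catC [:: s] [:: t]).
Qed.

Lemma ceq_size x y : ceq m x y -> size x = size y.
Proof. by move/ceq_perm/perm_size. Qed.

(** No commutation exchanges [s] with [t], so the projection to these two letters is an
    invariant. *)
Lemma ceq_filter s t x y : m s t <> 2 -> ceq m x y ->
  filter (pred2 s t) x = filter (pred2 s t) y.
Proof.
move=> st; elim=> {x y} [x|x y _ IH|x y z _ IH1 _ IH2|u v a b ab] //.
  by rewrite IH1.
rewrite !filter_cat /=; congr (_ ++ (_ ++ _)).
case: ifP => //; case: ifP => // /orP[]/eqP bE /orP[]/eqP aE; subst a b => //.
by rewrite mC ab in st.
Qed.

Lemma ceq_rev x y : ceq m x y -> ceq m (rev x) (rev y).
Proof.
elim=> {x y} [x|x y _ IH|x y z _ IH1 _ IH2|u v s t st] //.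
- exact: ceq_sym.
- exact: ceq_trans IH2.
- rewrite !rev_cat -!catA; apply: ceq_swap; by rewrite mC.
Qed.

Definition commutes s : pred S := [pred t | m s t == 2].

(** Left division by [s] in the partially commutative monoid, computed on words; [None] means that
    no [s] can be moved to the front. *)
Fixpoint pull s y : option (seq S) :=
  if y is a :: y' then
    if a == s then Some y'
    else if commutes s a then omap (cons a) (pull s y') else None
  else None.

Lemma pullP s y y' : pull s y = Some y' ->
  exists y1 y2, [/\ y = y1 ++ s :: y2, y' = y1 ++ y2 & all (commutes s) y1].
Proof.
elim: y y' => //= a y IH y'; case: eqP => [-> [<-]|_]; first by exists [::], y.
case: ifP => // sa; case E: (pull s y) => [z|] //= -[<-].
have [y1 [y2 [-> -> H]]] := IH _ E.
by exists (a :: y1), y2; split=> //=; rewrite -/(commutes s a) sa.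
Qed.

Definition oceq (o o' : option (seq S)) : Prop :=
  match o, o' with Some x, Some y => ceq m x y | None, None => True | _, _ => False end.

Lemma pull_ceq s x y : ceq m x y -> oceq (pull s x) (pull s y).
Proof.
elim=> {x y} [x|x y _ IH|x y z _ IH1 _ IH2|u v a b ab].
- by case: (pull s x) => /=.
- by case: (pull s x) (pull s y) IH => [?|] [?|] //=; exact: ceq_sym.
- case: (pull s x) (pull s y) (pull s z) IH1 IH2 => [?|] [?|] [?|] //=.
  exact: ceq_trans.
- have nab : a != b by apply/eqP => e; move: ab; rewrite e m1.
  elim: u => [|c u IH] /=; last first.
    case: eqP => [_ /=|_]; first exact: ceq_swap.
    case: ifP => // _; case: (pull s _) (pull s _) IH => [?|] [?|] //=.
    exact: (ceq_catl [:: c]).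
  rewrite /commutes /=; case: (eqVneq a s) => [sa|nas].
    by subst a; rewrite eq_sym (negbTE nab) ab eqxx /=.
  case: (eqVneq b s) => [sb|nbs]; first by subst b; rewrite mC ab eqxx /=.
  case: (m s a == 2); case: (m s b == 2); case: (pull s v) => //= w.
  exact: (ceq_swap [::]).
Qed.

(** Cancellation of a last letter, obtained by reversing the words and applying [pull], which
    respects commutation classes. *)
Lemma ceq_rcons_inv s x y : ceq m (rcons x s) y ->
  exists y1 y2, [/\ y = y1 ++ s :: y2, all (commutes s) y2 & ceq m x (y1 ++ y2)].
Proof.
move=> /ceq_rev/(pull_ceq s); rewrite rev_rcons /= eqxx.
case E: (pull s (rev y)) => [z|] //= H.
have [y2 [y1 [yE zE c]]] := pullP E; exists (rev y1), (rev y2).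
rewrite -(revK y) yE rev_cat rev_cons cat_rcons all_rev; split=> //.
by have := ceq_rev H; rewrite zE revK rev_cat.
Qed.

Lemma ceq_commutes s y : all (commutes s) y -> ceq m (rcons y s) (s :: y).
Proof.
elim: y => //= a y IH /andP[/eqP sa /IH H].
apply: ceq_trans (ceq_catl [:: a] H) _.
by apply: (ceq_swap [::]); rewrite mC.
Qed.

(** * Forbidden factors and full commutativity *)

Definition occurs p x := exists u v, ceq m x (u ++ p ++ v).

Lemma occurs_context p u x v : occurs p x -> occurs p (u ++ x ++ v).
Proof.
move=> [u' [v' /(ceq_context u v) H]]; exists (u ++ u'), (v' ++ v).
by rewrite -!catA in H *.
Qed.

Lemma occurs_ceq p x y : ceq m x y -> occurs p x -> occurs p y.
Proof. by move=> /ceq_sym xy [u [v H]]; exists u, v; apply: ceq_trans H. Qed.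

(** The alternative [k = 1] covers distinct letters that are equal in the group: replacing one by
    the other is not a commutation. *)
Definition forbidden_braid s t k :=
  [/\ s != t, is_braid m s t k & k = 1 \/ m s t <> 2].

Lemma forbidden_braid_sym s t k : forbidden_braid s t k -> forbidden_braid t s k.
Proof. by move=> [st /is_braid_sym b c]; split; rewrite // 1?eq_sym // mC. Qed.

Definition good x :=
  (forall s, ~ occurs [:: s; s] x) /\
  (forall s t k, forbidden_braid s t k -> ~ occurs (alt s t k) x).

Lemma good_ceq x y : ceq m x y -> good x -> good y.
Proof.
move=> /ceq_sym xy [H1 H2]; split=> [s /(occurs_ceq xy)/H1 //|].
by move=> s t k /H2 H /(occurs_ceq xy).
Qed.

Lemma good_factor u x v : good (u ++ x ++ v) -> good x.
Proof.
move=> [H1 H2]; split=> [s /(occurs_context u v)/H1 //|].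
by move=> s t k /H2 H /(occurs_context u v).
Qed.

(** The only braid moves applicable to a good word are trivial or commutations. Both claims are
    proved together, since symmetry and transitivity need goodness at the other end. *)
Lemma beq_good x y : beq m x y -> (good x <-> good y) /\ (good x -> ceq m x y).
Proof.
elim=> {x y} [x|x y _ [IH1 IH2]|x y z _ [IH1 IH2] _ [IH3 IH4]|u v s t k b] //.
- by split=> [|/IH1/IH2/ceq_sym //]; split=> /IH1.
- split; first exact: iff_trans IH3.
  by move=> gx; apply: ceq_trans (IH2 gx) (IH4 _); apply/IH1.
- have [f|nf] := EM (forbidden_braid s t k).
    have nx : ~ good (u ++ alt s t k ++ v) by move=> [_ /(_ _ _ _ f)]; apply; exists u, v.
    have ny : ~ good (u ++ alt t s k ++ v).
      by move=> [_ /(_ _ _ _ (forbidden_braid_sym f))]; apply; exists u, v.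
    by split.
  suff e : ceq m (alt s t k) (alt t s k).
    have {}e := ceq_context u v e; split=> //; split; apply: good_ceq => //.
    exact: ceq_sym.
  have [-> //|st] := eqVneq s t.
  have nk : ~ (k = 1 \/ m s t <> 2) by move=> c; apply: nf; split.
  have st2 : m s t = 2 by apply/eqP/negP => /negP/eqP; tauto.
  (* Length 1 is forbidden, and a length above 2 contradicts minimality because [s] and [t]
     commute. *)
  suff -> : k = 2 by apply: (ceq_swap [::] [::]).
  case: b => k0 _ H; case: k k0 H nk {nf} => [|[|[|k]]] // _ H; first tauto.
  by case: (H 2) => //; apply/ceq_weq/(ceq_swap [::] [::]).
Qed.

(** At the first failure, exchange rewrites the reduced good word [x] as [s :: u ++ v]; by
    Matsumoto's theorem this takes commutations only, so the square [ss] occurs in [s :: x]. *)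
Lemma good_reduced x : good x -> reduced m x.
Proof.
elim: x => [_ y //|s x IH g].
have gx : good x by apply: (@good_factor [:: s] x [::]); rewrite cats0.
have [//|nr] := EM (reduced m (s :: x)).
have [u [a [v [xE xu]]]] := exchange (IH gx) nr.
have ru : reduced m (s :: u ++ v).
  by apply: (reduced_weq (IH gx) xu); rewrite xE /= !size_cat addnS.
have [_ /(_ gx) e] := beq_good (matsumoto (IH gx) ru xu).
case: g => H _; case: (H s); exists [::], (u ++ v).
exact: (ceq_catl [:: s]).
Qed.

Lemma good_ceq_reduced x y : good x -> reduced m y -> weq m x y -> ceq m x y.
Proof.
move=> gx ry xy; have [_] := beq_good (matsumoto (good_reduced gx) ry xy).
exact.
Qed.

(** A square would allow shortening. A forbidden braid would lead to another reduced word outside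
    the commutation class: its letters differ if [k = 1], and its projection to [s] and [t] differs
    otherwise. *)
Lemma fc_word_good x : reduced m x -> fc_word m x -> good x.
Proof.
move=> rx fx; split=> [s|s t k [st [k0 b _] km]] [u [v e]].
  have := rx (u ++ v); rewrite (ceq_size e) !size_cat /= leq_add2l.
  rewrite -{2}[size v]add0n leq_add2r; move=> /(_ _)/negP [] //.
  by apply: weq_trans (ceq_weq e) _; exact: weq_inv.
have e' := weq_trans (ceq_weq e) (weq_context u v b).
have : ceq m (u ++ alt s t k ++ v) (u ++ alt t s k ++ v).
  apply: fx => //; last exact: ceq_weq.
    by apply: (reduced_weq rx); [exact: ceq_weq | rewrite (ceq_size e)].
  apply: (reduced_weq rx) => //.
  by rewrite (ceq_size e) !size_cat !size_alt.
case: km => [-> /ceq_perm|/ceq_filter H /H].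
  by rewrite perm_cat2l perm_cat2r => /perm_mem/(_ s); rewrite !inE eqxx (negbTE st).
rewrite !filter_cat => /(congr1 (drop (size (filter (pred2 s t) u)))).
rewrite !drop_size_cat //; case: k k0 {b e e' H} => //= k _.
by rewrite !eqxx orbT /= => -[e]; rewrite e eqxx in st.
Qed.

End Commutation.

(** * Closure properties of regular languages *)

Section RegularLanguages.
Set Implicit Arguments. Unset Strict Implicit. Unset Printing Implicit Defensive.
Variable S : finType.
Implicit Types (s : S) (x : seq S) (L : seq S -> Prop).

Lemma regular_ext L1 L2 : (forall x, L1 x <-> L2 x) -> regular L1 -> regular L2.
Proof. by move=> e [A H]; exists A => x; rewrite H. Qed.

Lemma regular_fold L (T : finType) (q0 : T) (delta : T -> S -> T) (acc : pred T) :
  (forall x, acc (foldl delta q0 x) <-> L x) -> regular L.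
Proof. by move=> H; exists (DFA q0 delta acc). Qed.

Lemma regular_not L : regular L -> regular (fun x => ~ L x).
Proof.
move=> [A H]; apply: (@regular_fold _ _ (dfa_start A) (@dfa_delta _ A) (predC (@dfa_accept _ A))).
by move=> x /=; rewrite -H; split=> /negP.
Qed.

Lemma foldl_pair (T U : Type) (f : T -> S -> T) (g : U -> S -> U) p q x :
  foldl (fun pq s => (f pq.1 s, g pq.2 s)) (p, q) x = (foldl f p x, foldl g q x).
Proof. by elim: x p q => /=. Qed.

Lemma regular_and L1 L2 : regular L1 -> regular L2 -> regular (fun x => L1 x /\ L2 x).
Proof.
move=> [A HA] [B HB]; apply: (@regular_fold _ (dfa_state A * dfa_state B)%type
  (dfa_start A, dfa_start B) (fun pq s => (dfa_delta pq.1 s, dfa_delta pq.2 s))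
  (fun pq => dfa_accept pq.1 && dfa_accept pq.2)) => x.
by rewrite foldl_pair /= -HA -HB; split=> /andP.
Qed.

Lemma regular_true : regular (fun _ : seq S => True).
Proof. by apply: (@regular_fold _ unit tt (fun _ _ => tt) predT). Qed.

Lemma regular_forall (I : finType) (L : I -> seq S -> Prop) :
  (forall i, regular (L i)) -> regular (fun x => forall i, L i x).
Proof.
move=> H; suff : regular (fun x => forall i, i \in enum I -> L i x).
  by apply: regular_ext => x; split=> Hx i => [|_]; apply: Hx; rewrite mem_enum.
elim: (enum I) => [|j r IH]; first by apply: regular_ext regular_true.
apply: regular_ext (regular_and (H j) IH) => x; split=> [[Hj Hr] i|Hx].
  by rewrite inE => /orP[/eqP-> //|/Hr].
split=> [|i ir]; first by apply: Hx; rewrite mem_head.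
by apply: Hx; rewrite inE ir orbT.
Qed.

End RegularLanguages.

(** * Lexicographic order on words *)

Section LexOrder.
Set Implicit Arguments. Unset Strict Implicit. Unset Printing Implicit Defensive.
Variables (S : finType) (lt : rel S).
Hypothesis lt_sto : strict_total_order lt.
Implicit Types (s a b : S) (x y z u v : seq S).

Let ltI s : lt s s = false. Proof. by case: lt_sto => /(_ s)/negbTE. Qed.
Let lt_trans s t a : lt s t -> lt t a -> lt s a. Proof. by case: lt_sto => _ [+ _]; apply. Qed.
Let lt_total s t : s != t -> lt s t || lt t s. Proof. by case: lt_sto => _ [_]; apply. Qed.

Lemma lexlt_irr x : lexlt lt x x = false.
Proof. by elim: x => //= a x ->; rewrite ltI andbF. Qed.

Lemma lexlt_trans y x z : lexlt lt x y -> lexlt lt y z -> lexlt lt x z.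
Proof.
elim: y x z => [|b y IH] [|a x] [|c z] //=.
case/orP=> [ab|/andP[/eqP-> xy]] /orP[bc|/andP[/eqP<- yz]].
- by rewrite (lt_trans ab bc).
- by rewrite ab.
- by rewrite bc.
- by rewrite eqxx (IH _ _ xy yz) orbT.
Qed.

Lemma lexlt_asym x y : lexlt lt x y -> lexlt lt y x -> False.
Proof. by move=> xy /(lexlt_trans xy); rewrite lexlt_irr. Qed.

Lemma lexlt_total x y : x <> y -> lexlt lt x y \/ lexlt lt y x.
Proof.
elim: x y => [|a x IH] [|b y] //=; try by [left | right].
have [->|/lt_total/orP[->|->]] := eqVneq a b; try by [left | right].
by move=> ne; rewrite ltI /=; apply: IH => e; rewrite e in ne.
Qed.

Lemma lexlt_catl u x y : lexlt lt (u ++ x) (u ++ y) = lexlt lt x y.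
Proof. by elim: u => //= a u ->; rewrite ltI eqxx. Qed.

Lemma lexlt_catr x y u v : size x = size y -> lexlt lt x y -> lexlt lt (x ++ u) (y ++ v).
Proof.
elim: x y => [|a x IH] [|b y] //= [xy] /orP[->//|/andP[-> /IH ->]] //.
by rewrite orbT.
Qed.

(** Either the first difference lies beyond [u], or it lies within [u] and what follows is
    irrelevant. *)
Lemma lexlt_cat_inv x u y : size x = size (u ++ y) -> lexlt lt x (u ++ y) ->
  (exists2 x', x = u ++ x' & lexlt lt x' y) \/
  (forall v w, lexlt lt (x ++ v) (u ++ w)).
Proof.
elim: u x => [|a u IH] x /=; first by left; exists x.
case: x => //= b x [xs] /orP[ba|/andP[/eqP -> /(IH _ xs)]].
  by right=> v w; rewrite ba.
case=> [[x' -> H]|H]; first by left; exists x'.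
by right=> v w; rewrite eqxx H orbT.
Qed.

(** There are finitely many words of length [n]; a scan of their list keeps the best candidate so
    far. *)
Lemma lexmin_exists (P : seq S -> Prop) n : (exists2 x, P x & size x = n) ->
  (forall x, P x -> size x = n) ->
  exists2 x, P x & forall y, P y -> y <> x -> lexlt lt x y.
Proof.
move=> [x0 Px0 x0n] Pn.
suff : forall ws : seq (seq S), forall x0, P x0 ->
    exists2 x, P x & forall y, P y -> y \in x0 :: ws -> y <> x -> lexlt lt x y.
  case/(_ [seq tval t | t : n.-tuple S] x0 Px0) => x Px Hx; exists x => // y Py.
  apply: Hx => //; rewrite inE; apply/orP; right.
  by apply/mapP; exists (tcast (Pn _ Py) (in_tuple y)); rewrite ?mem_enum ?val_tcast.
elim=> [|w ws IH] {x0n}{}x0 {}Px0.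
  by exists x0 => // y _; rewrite inE => /eqP.
have [x Px Hx] := IH _ Px0.
have [Pw|nPw] := EM (P w); last first.
  exists x => // y Py; rewrite !inE => /or3P[/eqP->|/eqP yw|yws]; last 1 first.
  - by apply: Hx => //; rewrite inE yws orbT.
  - by apply: Hx; rewrite // mem_head.
  - by rewrite yw in Py.
have [wx|nwx] := boolP (lexlt lt w x).
  exists w => // y Py; rewrite !inE orbCA => /orP[/eqP//|yin] _.
  have [-> //|/eqP yx] := eqVneq y x.
  by apply: lexlt_trans wx _; apply: Hx; rewrite // inE.
exists x => // y Py; rewrite !inE orbCA => /orP[/eqP -> wx|yin].
  by case: (lexlt_total wx) => //; rewrite (negbTE nwx).
by apply: Hx; rewrite // inE.
Qed.

End LexOrder.

(** * Automaton for minimality within a commutation class *)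

Section Automata.
Set Implicit Arguments. Unset Strict Implicit. Unset Printing Implicit Defensive.
Variables (S : finType) (m : S -> S -> nat) (lt : rel S).
Hypothesis m_cox : coxeter_matrix m.
Hypothesis lt_sto : strict_total_order lt.
#[local] Hint Resolve weq_refl ceq_refl : core.
Implicit Types (s t a b : S) (x y z u v p : seq S) (A : {set S}).

Let mC s t : m s t = m t s. Proof. by case: m_cox => _ []. Qed.

Definition ceq_lexmin x := forall y, ceq m x y -> y <> x -> lexlt lt x y.

(** An [a] appended to [x] could move left past the block [b :: u], giving a smaller word. *)
Definition can_insert x a :=
  exists w b u, [/\ x = w ++ b :: u, lt a b & all (commutes m a) (b :: u)].

Lemma can_insert_rcons x s a :
  can_insert (rcons x s) a <-> commutes m a s /\ (lt a s \/ can_insert x a).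
Proof.
split=> [[w [b [u []]]]|[as_ [lts|[w [b [u [-> ab bu]]]]]]].
- case/lastP: u => [|u c].
    by rewrite cats1 => /rcons_inj[_ <-] ab; rewrite /= andbT => cb; split; [|left].
  rewrite -rcons_cons -rcons_cat => /rcons_inj[-> ->] ab; rewrite all_rcons => /andP[cc bu].
  by split=> //; right; exists w, b, u.
- by exists x, s, [::]; rewrite cats1 /= as_.
- by exists w, b, (rcons u s); rewrite -rcons_cons -rcons_cat all_rcons as_ bu.
Qed.

(** An improvement of [x] survives appending [s], and an insertion of [s] is itself an improvement.
    Conversely, a word equivalent to [rcons x s] arises from some [y1 ++ y2] equivalent to [x] by
    inserting [s] before a block [y2] that commutes with it. *)
Lemma ceq_lexmin_rcons x s :
  ceq_lexmin (rcons x s) <-> ceq_lexmin x /\ ~ can_insert x s.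
Proof.
split=> [H|[H nins] y e ne].
  split=> [y xy yx|[w [b [u [xE sb /[dup] c /andP[cb _]]]]]].
    case: (lexlt_total lt_sto yx) => // yltx; exfalso.
    apply: (@lexlt_asym _ _ lt_sto (rcons y s) (rcons x s)).
      by rewrite -!cats1; apply: lexlt_catr => //; rewrite (ceq_size xy).
    apply: H; first by rewrite -!cats1; exact: ceq_catr.
    by move=> /rcons_inj[].
  have e : ceq m (rcons x s) (w ++ s :: b :: u).
    by rewrite xE rcons_cat; apply: ceq_catl; exact: ceq_commutes.
  have bs : b <> s by move=> bs; case: lt_sto => /(_ s); rewrite -{2}bs sb.
  have := H _ e; rewrite xE rcons_cat => {}H.
  apply: (@lexlt_asym _ _ lt_sto (w ++ s :: b :: u) (w ++ rcons (b :: u) s)).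
    by rewrite lexlt_catl //= sb.
  apply: H => /eqP; rewrite eqseq_cat // eqxx /= => /eqP [sb' _]; exact: bs.
have [y1 [y2 [yE c xy]]] := ceq_rcons_inv m_cox e.
(* If [x] starts with [y1], the next letter [b] of [x] is compared with [s]: it commutes with [s],
   hence differs from it, and [s] below [b] would make [s] insertable. *)
have key x' : x = y1 ++ x' -> lexlt lt (rcons x s) y.
  move=> xE; rewrite yE xE rcons_cat lexlt_catl //.
  have px : perm_eq x' y2 by rewrite -(perm_cat2l y1) -xE; exact: ceq_perm xy.
  case: x' xE px => [|b u] xE px.
    by case: ne; rewrite yE xE (size0nil (esym (perm_size px))) cats0 cats1.
  have cx : all (commutes m s) (b :: u) by rewrite (perm_all _ px).
  have bs : b != s.
    by apply/eqP => bs; move: cx; rewrite bs /= /commutes /=; case: m_cox => ->.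
  case: lt_sto => _ [_ /(_ _ _ bs)/orP[lbs|sb]]; first by rewrite /= lbs.
  by case: nins; exists y1, b, u.
have [/key //|/eqP/nesym ne'] := eqVneq x (y1 ++ y2).
case/lexlt_cat_inv: (H _ xy ne'); first exact: ceq_size xy.
  by move=> [x' /key].
by rewrite yE -cats1; apply.
Qed.

Lemma regular_ceq_lexmin : regular ceq_lexmin.
Proof.
(* [None] is a sink for words that are not minimal; [Some A] records the letters that can be
   inserted. *)
pose delta (q : option {set S}) s := if q is Some A then
  if s \in A then None else Some [set a | (m a s == 2) && (lt a s || (a \in A))]
  else None.
apply: (@regular_fold _ _ (option {set S}) (Some set0) delta isSome) => x.
suff : match foldl delta (Some set0) x with
       | Some A => ceq_lexmin x /\ forall a, a \in A <-> can_insert x a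
       | None => ~ ceq_lexmin x end.
  by case: (foldl _ _ _) => [A []|].
elim/last_ind: x => [|x s] /=.
  split=> [y /ceq_size/esym/size0nil -> //|a].
  by rewrite inE; split=> // -[[|? ?] [b [u []]]].
rewrite foldl_rcons; case: (foldl _ _ _) => [A [Hx HA]|Hx] /=; last first.
  by move/ceq_lexmin_rcons => [].
case: ifP => sA; first by move/ceq_lexmin_rcons => [_ []]; apply/HA.
split=> [|a]; first by apply/ceq_lexmin_rcons; split=> // /HA; rewrite sA.
rewrite inE can_insert_rcons -HA /commutes /=; split=> [/andP[-> /orP] //|[-> aA]].
exact/orP.
Qed.

Lemma cat_eq_cat_cons (z1 z2 y1 y2 : seq S) s : z1 ++ z2 = y1 ++ s :: y2 ->
  (exists z, z1 = y1 ++ s :: z /\ y2 = z ++ z2) \/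
  (exists z, z2 = z ++ s :: y2 /\ y1 = z1 ++ z).
Proof.
elim: z1 y1 => [|a z1 IH] y1 /= E; first by right; exists y1.
case: y1 E => [[-> <-]|b y1 [-> /IH[[z [-> ->]]|[z [-> ->]]]]].
- by left; exists z1.
- by left; exists z.
- by right; exists z.
Qed.

(** * Automaton for a factor up to commutation *)

Section Occurrences.
Variable p : seq S.
Hypothesis p_rigid : sorted (fun a b => m a b != 2) p.

Let index_set := ('I_(size p).+1 * {set S})%type.

Definition reach x (q : index_set) :=
  exists u v, ceq m x (u ++ take q.1 p ++ v) /\ [set a in v] = q.2.

(* The three cases: the new letter goes to the last, second or first block. *)
Definition occ_step s (q q' : index_set) : bool :=
  [|| (q'.1 == q.1) && (q'.2 == s |: q.2),
      [&& take q'.1 p == rcons (take q.1 p) s, q'.2 == q.2 & [forall a in q.2, commutes m s a]]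
    | [&& q' == q, [forall a in q.2, commutes m s a] & all (commutes m s) (take q.1 p)]].

Lemma all_commutes_set s v : [forall a in [set a in v], commutes m s a] = all (commutes m s) v.
Proof.
apply/forall_inP/allP => H a; last by rewrite inE; exact: H.
by move=> av; apply: H; rewrite inE.
Qed.

(** The appended [s] must commute with everything to its right in the factorization, and the block
    containing it determines the transition. *)
Lemma reach_rcons x s q' : reach (rcons x s) q' <-> exists2 q, reach x q & occ_step s q q'.
Proof.
split=> [[u [v [e vA]]]|[q [u [v [e vA]]]]]; last first.
  have es : ceq m (rcons x s) (u ++ take q.1 p ++ rcons v s).
    by rewrite -cats1 -rcons_cat -rcons_cat -cats1; exact: ceq_catr.
  rewrite /occ_step -vA all_commutes_set.
  case/or3P=> [/andP[/eqP i /eqP A']|/and3P[/eqP i /eqP A' /(ceq_commutes m_cox) c]|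
      /and3P[/eqP -> c1 c2]].
  - exists u, (rcons v s); rewrite i A'; split=> //.
    by apply/setP => a; rewrite !inE mem_rcons inE.
  - exists u, v; rewrite i A' cat_rcons; split=> //.
    by apply: ceq_trans es _; do 2!apply: ceq_catl.
  - exists (rcons u s), v; rewrite cat_rcons; split=> //.
    apply: ceq_trans es _; apply: ceq_catl; rewrite -rcons_cat.
    by apply: ceq_commutes => //; rewrite all_cat c2.
have [y1 [y2 [yE c xy]]] := ceq_rcons_inv m_cox e.
case: (cat_eq_cat_cons yE) => [[z [uE y2E]]|[z [pvE y1E]]].
  exists q'; last first.
    apply/or3P/Or33; move: c; rewrite y2E !all_cat => /and3P[_ -> cv].
    by rewrite eqxx -vA all_commutes_set cv.
  by exists (y1 ++ z), v; rewrite -catA -y2E.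
rewrite y1E -catA in xy.
case: (cat_eq_cat_cons pvE) => [[w [pE y2E]]|[w [vE zE]]]; last first.
  exists (q'.1, [set a in w ++ y2]).
    by exists u, (w ++ y2); rewrite zE -catA in xy.
  apply/or3P/Or31; rewrite eqxx /= -vA vE; apply/eqP/setP => a.
  by rewrite !inE !mem_cat !inE orbCA.
(* Here [s] lies in the part of [p]. The next letter of [p] would have to commute with [s], against
   rigidity, so [s] ends that part. *)
have w0 : w = [::].
  case: w pE y2E => // b w pE y2E.
  have : sorted (fun a b => m a b != 2) (take q'.1 p) by exact: take_sorted.
  rewrite pE; case: z {pvE y1E xy pE} => [|d z] /=.
    by case/andP=> /negbTE sb; move: c; rewrite y2E /= /commutes /= sb.
  by rewrite cat_path /= => /and3P[_ _ /andP[/negbTE sb]]; move: c; rewrite y2E /= /commutes /= sb.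
move: pE y2E; rewrite w0 /= => pE y2E.
have szz : size z < size p.
  have := congr1 size pE; rewrite size_take_min size_cat /= addn1 => <-.
  exact: geq_minr.
have zE : take (size z) p = z.
  have := congr1 (take (size z)) pE; rewrite take_size_cat // take_takel //.
  have := congr1 size pE; rewrite size_take_min size_cat /= addn1 => H.
  by apply: leq_trans (leqnSn _) _; rewrite -H geq_minl.
exists (Ordinal (ltnW szz : size z < (size p).+1), q'.2).
  by exists u, v; rewrite /= zE; rewrite y2E in xy.
apply/or3P/Or32; rewrite /= zE pE cats1 !eqxx /= -vA all_commutes_set.
by rewrite -y2E.
Qed.

(** Subset construction: the state is the set of all pairs reached, and it accepts when all of [p]
    has been read in some pair. *)
Lemma regular_occurs : regular (occurs m p).
Proof.
pose delta (Q : {set index_set}) s := [set q' | [exists q in Q, occ_step s q q']].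
pose q0 : {set index_set} := [set q : index_set | (take q.1 p == [::]) && (q.2 == set0)].
apply: (@regular_fold _ _ {set index_set} q0 delta
  (fun Q => [exists A : {set S}, (ord_max, A) \in Q])) => x.
have -> : occurs m p x <-> exists A, reach x (ord_max, A).
  split=> [[u [v H]]|[A [u [v [H _]]]]]; last by exists u, v; rewrite take_size in H.
  by exists [set a in v], u, v; rewrite /= take_size.
suff HQ q : q \in foldl delta q0 x <-> reach x q.
  by split=> [/existsP[A /HQ]|[A /HQ HA]]; [exists A | apply/existsP; exists A].
elim/last_ind: x q => [|x s IH] q /=.
  rewrite inE; split=> [/andP[/eqP p0 /eqP v0]|[u [v [/ceq_size]]]].
    by exists [::], [::]; rewrite p0 v0; split=> //; apply/setP => a; rewrite !inE.
  rewrite !size_cat => /esym/eqP; rewrite !addn_eq0 => /and3P[_ /nilP -> /nilP ->] <-.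
  by rewrite eqxx; apply/eqP/setP => a; rewrite !inE.
rewrite foldl_rcons reach_rcons inE; split=> [/exists_inP[q1 /IH]|[q1 /IH H1 H2]].
  by exists q1.
by apply/exists_inP; exists q1.
Qed.

End Occurrences.

(** * Regularity of the language and choice of representatives *)

Lemma alt_rigid s t k : k = 1 \/ m s t <> 2 -> sorted (fun a b => m a b != 2) (alt s t k).
Proof.
case=> [-> //|/eqP st]; case: k => //= k.
elim: k s t st => //= k IH s t st; rewrite st; apply: IH; by rewrite mC.
Qed.

(** Minimality in [is_braid] leaves at most one length [k] for each pair of letters, so finitely
    many rigid factors are to be avoided. *)
Lemma regular_good : regular (good m).
Proof.
apply: regular_and; apply: regular_forall => s.
  by apply/regular_not/regular_occurs; case: m_cox => /= ->.
apply: regular_forall => t.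
have [[k f]|nf] := EM (exists k, forbidden_braid m s t k); last first.
  by apply: regular_ext (regular_true S) => x; split=> // _ k f; case: nf; exists k.
have [_ b c] := f.
apply: (@regular_ext _ (fun x => ~ occurs m (alt s t k) x)) => [x|].
  split=> [H k' [_ b' _]|H]; last exact: H.
  suff -> : k' = k by [].
  case: b b' => k0 e H1 [k0' e' H1'].
  case: (ltngtP k' k) => // kk; first by case: (H1 k'); rewrite ?k0'.
  by case: (H1' k); rewrite ?k0.
exact/regular_not/regular_occurs/alt_rigid.
Qed.

(** The reduced words of a fully commutative element form one commutation class, so the two notions
    of minimality agree. *)
Lemma FC_langP x : FC_lang m lt x <-> good m x /\ ceq_lexmin x.
Proof.
split=> [[[rx lx] fx]|[gx lx]].
  split=> [|y xy]; first exact: fc_word_good.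
  have xy' := ceq_weq xy.
  by apply: lx => //; apply: (reduced_weq rx) => //; rewrite (ceq_size xy).
have rx := good_reduced m_cox gx; have cx := good_ceq_reduced m_cox gx.
split; first by split=> // y ry xy; apply: lx; exact: cx.
move=> y z ry rz /(cx _ ry)/ceq_sym xy /(cx _ rz); exact: ceq_trans.
Qed.

Lemma fc_word_weq x y : weq m x y -> fc_word m x -> fc_word m y.
Proof.
by move=> xy fx u v ru rv yu yv; apply: fx => //; [move: yu | move: yv]; exact: weq_trans.
Qed.

Lemma lexmin_representative y : reduced m y ->
  exists x, [/\ size x = size y, weq m y x & is_lexmin m lt x].
Proof.
move=> ry; have [||x [rx yx] Hx] := @lexmin_exists _ _ lt_sto
  (fun x => reduced m x /\ weq m y x) (size y).
- by exists y.
- by move=> x [rx yx]; rewrite (weq_reduced_size ry rx).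
- exists x; rewrite -(weq_reduced_size ry rx) //; split=> //; split=> // z rz xz.
  by apply: Hx; split=> //; exact: weq_trans xz.
Qed.

Lemma is_lexmin_inj x y : is_lexmin m lt x -> is_lexmin m lt y -> weq m x y -> x = y.
Proof.
move=> [rx Hx] [ry Hy] xy; apply/eqP/negP => /negP/eqP ne.
apply: (@lexlt_asym _ _ lt_sto x y); first exact: Hx (nesym ne).
by apply: Hy => //; exact: weq_sym.
Qed.

End Automata.

Theorem theorem3p6 (S : finType) (m : S -> S -> nat) (lt : rel S) :
  coxeter_matrix m -> strict_total_order lt ->
  regular (FC_lang m lt) /\
  (forall n c : nat,
     num_words_of_length (FC_lang m lt) n c -> num_FC_of_length m n c).
Proof.
move=> m_cox lt_sto; split=> [|n c [ws [wsc [uws Hws]]]].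
  apply: regular_ext (regular_and (regular_good m_cox) (regular_ceq_lexmin m_cox lt_sto)).
  by move=> x; rewrite (FC_langP lt m_cox).
(* The minimal words themselves serve as representatives: each element has exactly one. *)
exists ws; split=> //; split; first by move=> x /Hws[xn [[rx _] fx]].
split=> [i j iw jw e|y yn ry fy].
  have lx k : k < size ws -> is_lexmin m lt (nth [::] ws k).
    by move=> /(mem_nth [::])/Hws[_ []].
  by apply/eqP; rewrite -(nth_uniq [::] iw jw uws) (is_lexmin_inj lt_sto _ _ e) //; exact: lx.
have [x [xs yx lx]] := lexmin_representative lt_sto ry.
exists x; last exact: weq_sym.
by apply/Hws; rewrite xs; split=> //; split=> //; exact: fc_word_weq fy.
Qed.
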